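(* Let $q\ge2$, $n\ge1$ and $0\le k\le n$ be integers. Suppose $f:\{0,1,\ldots,q-1\}^n\to\mathbb R$ satisfies the bounded differences condition with parameters $(c_1,\ldots,c_n)$, and let $\boldsymbol\eta$ be drawn uniformly at random from $\{0,1,\ldots,q-1\}^n$ subject to $\mathrm{wt}(\boldsymbol\eta)=k$. Then $$\mathbb P\bigl(|f(\boldsymbol\eta)-\mathbb E f(\boldsymbol\eta)|\ge t\bigr)\le2\exp\left(-\frac{t^2}{68\sum_{i=1}^nc_i^2}\right)\quad\text{for all }t\ge0.$$
   Context: For $x\in\{0,1,\ldots,q-1\}^n$, the weight $\mathrm{wt}(x)$ is the number of nonzero entries of $x$. A function $f:\Omega^n\to\mathbb R$ satisfies the bounded differences condition with parameters $(c_1,\ldots,c_n)\in\mathbb R^n$ if for every $x,x'\in\Omega^n$, $|f(x)-f(x')|\le\sum_{i=1}^nc_i\mathbf 1_{\{x_i\ne x_i'\}}$. *)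

(* Defs.v *)
From HB Require Import structures.
From mathcomp Require Import all_boot all_order all_algebra.
From mathcomp Require Import all_classical all_reals all_analysis.

Set Implicit Arguments.
Unset Strict Implicit.
Unset Printing Implicit Defensive.

Import Order.TTheory GRing.Theory Num.Theory.
Import numFieldNormedType.Exports.

Local Open Scope classical_set_scope.
Local Open Scope ring_scope.

Definition wt (q n : nat) (x : {ffun 'I_n -> 'I_q}) : nat :=
  #|[pred i | (x i : nat) != 0%N]|.

Definition bounded_differences (R : realType) (Omega : eqType) (n : nat)
    (c : 'I_n -> R) (f : {ffun 'I_n -> Omega} -> R) : Prop :=
  forall x y : {ffun 'I_n -> Omega},
    `|f x - f y| <= \sum_(i < n) c i * (x i != y i)%:R.

(* The values of [eta] form a finite type that carries no sigma-algebra, so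
   measurability of [eta] is required through its fibres. *)
Definition uniform_on (d : measure_display) (T : measurableType d) (R : realType)
    (P : probability T R) (S : finType) (eta : T -> S) (A : {set S}) : Prop :=
  forall x : S,
    measurable (eta @^-1` [set x]) /\
    P (eta @^-1` [set x]) = (if x \in A then #|A|%:R^-1 else 0)%:E.

(* Main.v *)
Require Import Defs.
From HB Require Import structures.
From mathcomp Require Import all_boot all_order all_algebra.
From mathcomp Require Import all_classical all_reals all_analysis.
From mathcomp Require Import perm ring lra.

(** The proof reveals the coordinates of a uniform vector of weight [k] one at
    a time and controls the resulting martingale, largest [c i] first.

    After some coordinates have been revealed, the vector is uniform on a
    slice: the vectors of weight [k] with prescribed values off a set [S] of
    coordinates.  Let [i] maximise [c] on [S].  Revealing coordinate [i] cuts
    the slice into cells, and the conditional means of [f] on two cells differ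
    by at most [2 * c i] ([mean_cell_close]).  If both values at [i] are
    nonzero, changing one into the other is a bijection between the cells, of
    cost [c i].  If one of them is zero, the weight left for the remaining
    coordinates is different, and the cells need not have the same size; but
    exchanging the zero at [i] with a nonzero entry at some other [j] in [S],
    then setting the value at [i], gives a biregular bipartite graph between
    the two cells.  Averaging over its edges compares the two means, at a cost
    of at most [c i + c j <= 2 * c i], by the choice of [i].

    The elementary inequality [expR x <= x + expR (2 * x ^+ 2)] turns a centred
    increment bounded by [2 * c i] into a factor [expR (8 * c i ^+ 2)] of the
    exponential moment, so induction on [S] bounds that moment by
    [expR (8 * \sum_(i in S) c i ^+ 2)] ([slice_mgf]).  Chernoff's method,
    applied to [f] and [- f] with the parameter [t / (16 * C)],
    [C := \sum_i c i ^+ 2], gives the tail [2 * expR (- t ^+ 2 / (32 * C))]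
    ([slice_tail]), which is stronger than the claim because [32 <= 68]. *)

Set Implicit Arguments.
Unset Strict Implicit.
Unset Printing Implicit Defensive.

Import Order.TTheory GRing.Theory Num.Theory.
Import numFieldNormedType.Exports.

Local Open Scope ring_scope.

(** * Means over finite sets and exponential moments *)

(** A substitute for Hoeffding's lemma: averaged over a centred variable, the
    linear term vanishes and only a quadratic exponent is left.
    For [x <= 1/2] it follows from [expR x <= (1 - x)^-1], and for larger [x]
    from [x <= 2 * x ^+ 2]. *)
Lemma expR_le_add (R : realType) (x : R) : expR x <= x + expR (2 * x ^+ 2).
Proof.
have [xle|xgt] := leP x (1 / 2).
  have x1 : 0 < 1 - x by lra.
  have h1 : expR x <= (1 - x)^-1.
    rewrite -[x in expR x]opprK expRN lef_pV2 ?posrE ?expR_gt0 //.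
    by have := expR_ge1Dx (- x).
  have h2 : (1 - x)^-1 <= 1 + x + 2 * x ^+ 2.
    rewrite -[X in X <= _]mul1r ler_pdivrMr //; nra.
  have := expR_ge1Dx (2 * x ^+ 2); lra.
have : expR x <= expR (2 * x ^+ 2) by rewrite ler_expR; nra.
lra.
Qed.

Definition mean (R : realType) (X : finType) (A : {set X}) (f : X -> R) : R :=
  (\sum_(y in A) f y) / #|A|%:R.

Lemma mean_card (R : realType) (X : finType) (A : {set X}) (f : X -> R) :
  #|A|%:R * mean A f = \sum_(y in A) f y.
Proof.
rewrite /mean mulrC; have [->|An0] := eqVneq A finset.set0.
  by rewrite big_set0 !mul0r.
by rewrite divfK // pnatr_eq0 cards_eq0.
Qed.

Lemma meanZ (R : realType) (X : finType) (A : {set X}) (f : X -> R) (a : R) :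
  mean A (fun y => a * f y) = a * mean A f.
Proof. by rewrite /mean -mulr_sumr mulrA. Qed.

Lemma dist_mean_le (R : realType) (X : finType) (A : {set X}) (f : X -> R)
    (r D : R) :
  A != finset.set0 -> (forall y, y \in A -> `|r - f y| <= D) ->
  `|r - mean A f| <= D.
Proof.
move=> An0 rf; have cA : 0 < #|A|%:R :> R by rewrite ltr0n card_gt0.
rewrite -(ler_pM2l cA) -[X in X * `|_|]gtr0_norm // -normrM mulrBr mean_card.
rewrite mulr_natl -sumr_const -sumrB mulr_natl -sumr_const.
by apply: le_trans (ler_norm_sum _ _ _) _; apply: ler_sum.
Qed.

(** The set [Q] of edges joins [l e] to [r e]; the two sum conditions say that
    it is biregular, every point of [A] having degree [a] and every point of
    [B] degree [b].  Both means are then averages over the same set of edges. *)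
Lemma mean_coupling (R : realType) (X E : finType) (A B : {set X}) (Q : pred E)
    (l r : E -> X) (a b : nat) (f : X -> R) (D : R) :
  A != finset.set0 -> B != finset.set0 -> (0 < a)%N -> (0 < b)%N ->
  (forall g : X -> R, \sum_(e | Q e) g (l e) = a%:R * \sum_(y in A) g y) ->
  (forall g : X -> R, \sum_(e | Q e) g (r e) = b%:R * \sum_(y in B) g y) ->
  (forall e, Q e -> `|f (l e) - f (r e)| <= D) ->
  `|mean A f - mean B f| <= D.
Proof.
move=> An0 Bn0 a0 b0 suml sumr close.
pose N : R := \sum_(e | Q e) 1.
have NA : N = a%:R * #|A|%:R.
  by rewrite /N (suml (fun=> 1)) sumr_const.
have NB : N = b%:R * #|B|%:R.
  by rewrite /N (sumr (fun=> 1)) sumr_const.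
have N0 : 0 < N by rewrite NA mulr_gt0 ?ltr0n ?card_gt0.
have fA : N * mean A f = \sum_(e | Q e) f (l e).
  by rewrite NA -mulrA mean_card suml.
have fB : N * mean B f = \sum_(e | Q e) f (r e).
  by rewrite NB -mulrA mean_card sumr.
rewrite -(ler_pM2l N0) -[X in X * `|_|]gtr0_norm // -normrM mulrBr fA fB.
rewrite -sumrB /N mulr_suml; apply: le_trans (ler_norm_sum _ _ _) _.
by apply: ler_sum => e Qe; rewrite mul1r close.
Qed.

(** One step of the martingale argument: [v] bounds the exponent of the moment
    inside each fibre of [g], and [D] bounds the fluctuation of the fibre
    means, which are centred around the mean over [A]. *)
Lemma sum_expR_partition (R : realType) (X Y : finType) (A : {set X})
    (g : X -> Y) (f : X -> R) (D v : R) :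
  let fiber z := [set y in A | g y == z]%SET in
  (forall z1 z2, fiber z1 != finset.set0 -> fiber z2 != finset.set0 ->
     `|mean (fiber z1) f - mean (fiber z2) f| <= D) ->
  (forall z, \sum_(y in fiber z) expR (f y - mean (fiber z) f) <=
     #|fiber z|%:R * expR v) ->
  \sum_(y in A) expR (f y - mean A f) <= #|A|%:R * expR (v + 2 * D ^+ 2).
Proof.
move=> fiber closeD fiberv.
have split_sum (h : X -> R) : \sum_(y in A) h y = \sum_z \sum_(y in fiber z) h y.
  rewrite (partition_big g predT) //=; apply: eq_bigr => z _.
  by apply: eq_bigl => y; rewrite inE.
have split_card : #|A|%:R = \sum_z #|fiber z|%:R :> R.
  rewrite -sumr_const split_sum; apply: eq_bigr => z _.
  by rewrite sumr_const.
pose del z := mean (fiber z) f - mean A f.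
have del0 : \sum_z #|fiber z|%:R * del z = 0.
  under eq_bigr => z _ do rewrite mulrBr mean_card.
  by rewrite sumrB -split_sum -mulr_suml -split_card mean_card subrr.
have delD z : fiber z != finset.set0 -> `|del z| <= D.
  move=> zn0.
  have An0 : A != finset.set0.
    by case/set0Pn: zn0 => y; rewrite inE => /andP[yA _]; apply/set0Pn; exists y.
  rewrite /del; have -> : mean A f = mean A (fun y => mean (fiber (g y)) f).
    rewrite /mean !split_sum; congr (_ / _); apply: eq_bigr => z' _.
    rewrite -mean_card -[RHS]mean_card; have [->|cn0] := eqVneq #|fiber z'| 0%N.
      by rewrite !mul0r.
    congr (_ * _); rewrite [RHS]/mean.
    under eq_bigr => y do rewrite inE => /andP[_ /eqP->].
    by rewrite sumr_const -[X in X / _]mulr_natl mulrAC mulfV ?mul1r ?pnatr_eq0.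
  apply: dist_mean_le => // y yA; apply: closeD => //.
  by apply/set0Pn; exists y; rewrite inE yA eqxx.
rewrite split_sum.
have step z : \sum_(y in fiber z) expR (f y - mean A f) <=
    expR v * (#|fiber z|%:R * del z + #|fiber z|%:R * expR (2 * D ^+ 2)).
  have [c0|cn0] := eqVneq (fiber z) finset.set0.
    by rewrite c0 big_set0 cards0 !mul0r addr0 mulr0.
  have -> : \sum_(y in fiber z) expR (f y - mean A f) =
      expR (del z) * \sum_(y in fiber z) expR (f y - mean (fiber z) f).
    rewrite mulr_sumr; apply: eq_bigr => y _; rewrite -expRD; congr expR.
    rewrite /del; ring.
  apply: le_trans (ler_wpM2l (expR_ge0 _) (fiberv z)) _.
  rewrite -mulrDr mulrCA [X in _ <= X]mulrCA ler_wpM2l ?ler0n //.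
  rewrite mulrC ler_wpM2l ?expR_ge0 //.
  apply: le_trans (expR_le_add _) _.
  rewrite lerD2l ler_expR ler_pM2l // -real_normK ?num_real //.
  have := delD z cn0; have := normr_ge0 (del z) => *; nra.
apply: le_trans (ler_sum _ (fun z _ => step z)) _.
by rewrite -mulr_sumr big_split /= del0 add0r -mulr_suml -split_card mulrCA -expRD.
Qed.

(** * Slices of the weight-k vectors *)

Lemma bounded_differences_on (R : realType) (W : eqType) (n : nat)
    (c : 'I_n -> R) (f : {ffun 'I_n -> W} -> R) (U : {set 'I_n})
    (x y : {ffun 'I_n -> W}) :
  (forall i, 0 <= c i) -> bounded_differences c f ->
  (forall i, i \notin U -> x i = y i) ->
  `|f x - f y| <= \sum_(i in U) c i.
Proof.
move=> c0 bdf xy; apply: le_trans (bdf x y) _.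
rewrite [X in _ <= X]big_mkcond; apply: ler_sum => i _ /=.
case: ifPn => [_|/xy->]; last by rewrite eqxx mulr0.
by case: (x i != y i); rewrite ?mulr1 ?mulr0.
Qed.

(** Two letters are needed: with a single one the condition is vacuous. *)
Lemma bounded_differences_ge0 (R : realType) (W : eqType) (n : nat)
    (c : 'I_n -> R) (f : {ffun 'I_n -> W} -> R) (a b : W) :
  a != b -> bounded_differences c f -> forall i, 0 <= c i.
Proof.
move=> ab bdf i.
have := bdf [ffun=> a] [ffun l => if l == i then b else a].
rewrite (bigD1 i) //= big1 => [|l li]; last first.
  by rewrite !ffunE (negbTE li) eqxx mulr0.
by rewrite !ffunE eqxx ab mulr1 addr0; apply: le_trans.
Qed.

Section Slices.
Variables (W : finType) (o : W) (n : nat).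
Implicit Types (x y z : {ffun 'I_n -> W}) (S : {set 'I_n}) (i j : 'I_n).

Definition weight x : nat := #|[pred j | x j != o]|.

(** Fixing the total weight, instead of the weight on [S], makes a cell of a
    slice again a slice with the same [k] ([cell_slice]). *)
Definition slice (k : nat) S x : {set {ffun 'I_n -> W}} :=
  [set y | (weight y == k) && [forall j, (j \notin S) ==> (y j == x j)]]%SET.

Definition cell k S x i (a : W) : {set {ffun 'I_n -> W}} :=
  [set y in slice k S x | y i == a]%SET.

Definition setval i (a : W) x : {ffun 'I_n -> W} :=
  [ffun l => if l == i then a else x l].

Definition swap i j x : {ffun 'I_n -> W} := [ffun l => x (tperm i j l)].

Lemma swapK i j : involutive (swap i j).
Proof. by move=> x; apply/ffunP => l; rewrite !ffunE tpermK. Qed.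

Lemma slice_agree k S x y j : y \in slice k S x -> j \notin S -> y j = x j.
Proof.
by rewrite inE => /andP[_ /forallP/(_ j)/implyP h] jS; apply/eqP/h.
Qed.

Lemma cell_slice k S x i (a : W) : i \in S ->
  cell k S x i a = slice k (S :\ i) (setval i a x).
Proof.
move=> iS; apply/setP => y; rewrite !inE -andbA; congr (_ && _).
apply/andP/forallP => [[/forallP h yia] j|h].
  rewrite !inE ffunE; have [->|_] //= := eqVneq j i.
split; last by have := h i; rewrite !inE ffunE eqxx.
apply/forallP => j; have := h j; rewrite !inE ffunE.
by have [->|//] := eqVneq j i; rewrite iS.
Qed.

Lemma weight_swap i j x : weight (swap i j x) = weight x.
Proof.
rewrite /weight -!sum1_card [RHS](reindex_inj (@perm_inj _ (tperm i j))) /=.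
by apply: eq_bigl => l; rewrite !inE ffunE.
Qed.

Lemma weight_setval i a x : a != o -> x i != o -> weight (setval i a x) = weight x.
Proof.
move=> ao xio; apply: eq_card => l; rewrite !inE ffunE.
by have [->|//] := eqVneq l i; rewrite ao xio.
Qed.

Lemma setval_id i x : setval i (x i) x = x.
Proof. by apply/ffunP => l; rewrite ffunE; have [->|] := eqVneq l i. Qed.

Lemma setval_setval i a b x : setval i a (setval i b x) = setval i a x.
Proof. by apply/ffunP => l; rewrite !ffunE; case: eqVneq. Qed.

Lemma setvalE i a x : setval i a x i = a.
Proof. by rewrite ffunE eqxx. Qed.

Lemma slice_setval k S x i a y : i \in S -> a != o -> y i != o ->
  (setval i a y \in slice k S x) = (y \in slice k S x).
Proof.
move=> iS ao yio; rewrite !inE weight_setval //; congr (_ && _).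
apply: eq_forallb => j; rewrite ffunE.
by have [->|//] := eqVneq j i; rewrite iS.
Qed.

Lemma slice_swap k S x i j y : i \in S -> j \in S ->
  (swap i j y \in slice k S x) = (y \in slice k S x).
Proof.
move=> iS jS; rewrite !inE weight_swap; congr (_ && _).
apply: eq_forallb => l; case: (boolP (l \in S)) => //= lS.
by rewrite ffunE tpermD //; apply: contraNneq lS => <-.
Qed.

Lemma sum_cell_setval (R : realType) k S x i a b (g : _ -> R) :
  i \in S -> a != o -> b != o ->
  \sum_(y in cell k S x i a) g (setval i b y) = \sum_(y in cell k S x i b) g y.
Proof.
move=> iS ao bo.
rewrite [RHS](reindex_onto (setval i b) (setval i a)) /=; last first.
  by move=> y; rewrite inE setval_setval => /andP[_ /eqP<-]; apply: setval_id.
apply: eq_bigl => y; rewrite setval_setval [in LHS]inE [in RHS]inE.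
rewrite setvalE eqxx andbT.
have [yia|yia] := eqVneq (y i) a.
  by rewrite slice_setval ?yia // -[in setval i a y]yia setval_id eqxx.
rewrite andbF; apply/esym/negbTE; rewrite negb_and; apply/orP; right.
by apply: contraNneq yia => <-; rewrite setvalE.
Qed.

Lemma sum_slice_swap (R : realType) k S x i j (g : _ -> R) :
  i \in S -> j \in S ->
  \sum_(y in slice k S x | (y i == o) && (y j != o)) g (swap i j y) =
  \sum_(z in slice k S x | (z i != o) && (z j == o)) g z.
Proof.
move=> iS jS; rewrite [RHS](reindex_inj (inv_inj (@swapK i j))) /=.
apply: eq_bigl => y.
by rewrite slice_swap // !ffunE tpermL tpermR [in RHS](andbC (y j != o)).
Qed.

(** This count depends on the slice only, which is what makes the exchange
    graph of [mean_cell_zero] biregular. *)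
Lemma card_support_slice k S x y : y \in slice k S x ->
  #|[set j in S | y j != o]%SET| =
  (k - #|[set j in ~: S | x j != o]%SET|)%N.
Proof.
move=> yS; have /eqP wy : weight y == k by move: yS; rewrite inE => /andP[].
have -> : [set j in ~: S | x j != o]%SET = [set j in ~: S | y j != o]%SET.
  apply/setP => j; rewrite !inE; case: (boolP (j \in S)) => //= jS.
  by rewrite (slice_agree yS jS).
rewrite -wy /weight -[X in (X - _)%N]cardsE -(cardsID S [set j | y j != o]%SET).
rewrite (_ : _ :&: S = [set j in S | y j != o]%SET); last first.
  by apply/setP => j; rewrite !inE andbC.
rewrite (_ : _ :\: S = [set j in ~: S | y j != o]%SET) ?addnK //.
by apply/setP => j; rewrite !inE.
Qed.

(** The edges are the pairs [(y, j)] with [y i = o], [j] in [S] and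
    [y j != o].  With [m] the number of nonzero entries that vectors of the
    slice have in [S], each [y] lies on [m] edges.  After the swap, the other
    endpoint has a nonzero value at [i], which is overwritten by [b]: an
    element of the target cell arises from each of its [#|S| - m] zeros in [S]
    and from each nonzero value that may have stood at [i]. *)
Lemma mean_cell_zero (R : realType) k S x i b (f : _ -> R) (D : R) :
  i \in S -> b != o ->
  cell k S x i o != finset.set0 -> cell k S x i b != finset.set0 ->
  (forall y j, y \in cell k S x i o -> j \in S -> y j != o ->
     `|f y - f (setval i b (swap i j y))| <= D) ->
  `|mean (cell k S x i o) f - mean (cell k S x i b) f| <= D.
Proof.
move=> iS bo Ao0 Ab0 close.
pose m := (k - #|[set j in ~: S | x j != o]%SET|)%N.
pose Q (e : {ffun 'I_n -> W} * 'I_n) :=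
  (e.1 \in cell k S x i o) && ((e.2 \in S) && (e.1 e.2 != o)).
pose nz := #|[pred a | a != o]|.
have supp y : y \in slice k S x -> #|[pred j in S | y j != o]| = m.
  by move/card_support_slice; rewrite cardsE.
have zeros y : y \in slice k S x -> #|[pred j in S | y j == o]| = (#|S| - m)%N.
  move=> /supp <-; rewrite -(cardID [pred j | y j != o] (mem S)).
  rewrite (_ : #|[predI mem S & [pred j | y j != o]]| = #|[pred j in S | y j != o]|);
    last by apply: eq_card => j; rewrite !inE.
  by rewrite addKn; apply: eq_card => j; rewrite !inE negbK andbC.
have m0 : (0 < m)%N.
  case/set0Pn: Ab0 => z; rewrite inE => /andP[zS /eqP zib].
  by rewrite -(supp z zS); apply/card_gt0P; exists i; rewrite !inE iS zib.
have mS : (0 < #|S| - m)%N.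
  case/set0Pn: Ao0 => z; rewrite inE => /andP[zS /eqP zio].
  by rewrite -(zeros z zS); apply/card_gt0P; exists i; rewrite !inE iS zio eqxx.
have nz0 : (0 < nz)%N by apply/card_gt0P; exists b.
apply: (@mean_coupling _ _ _ _ _ Q fst (fun e => setval i b (swap i e.2 e.1))
  m ((#|S| - m) * nz)%N) => //.
- by rewrite muln_gt0 mS.
- move=> g; rewrite -(pair_big_dep (fun y => y \in cell k S x i o)
    (fun y j => (j \in S) && (y j != o)) (fun y _ => g y)) /= mulr_sumr.
  apply: eq_bigr => y; rewrite inE => /andP[yS _].
  by rewrite sumr_const (supp y yS) mulr_natl.
- move=> g; rewrite -(pair_big_dep (fun y => y \in cell k S x i o)
    (fun y j => (j \in S) && (y j != o))
    (fun y j => g (setval i b (swap i j y)))) /=.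
  rewrite (exchange_big_dep (fun j => j \in S)) /=; last by move=> y j _ /andP[].
  have swapped j : j \in S ->
      \sum_(y | (y \in cell k S x i o) && ((j \in S) && (y j != o)))
        g (setval i b (swap i j y)) =
      \sum_(z in slice k S x | (z i != o) && (z j == o)) g (setval i b z).
    move=> jS; rewrite -(sum_slice_swap k x (fun z => g (setval i b z)) iS jS).
    by apply: eq_bigl => y; rewrite !inE jS /= -!andbA.
  rewrite (eq_bigr _ swapped).
  rewrite (exchange_big_dep (fun z => (z \in slice k S x) && (z i != o))) /=;
    last by move=> j z _ /and3P[-> ->].
  transitivity (\sum_(z in slice k S x | z i != o)
      (#|S| - m)%:R * g (setval i b z)).
    apply: eq_bigr => z /andP[zS zio]; rewrite -(zeros z zS) mulr_natl.
    rewrite -sumr_const; apply: eq_bigl => j; rewrite zS zio /=.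
    by rewrite !inE.
  rewrite -mulr_sumr natrM -mulrA; congr (_ * _).
  rewrite (partition_big (fun z : {ffun 'I_n -> W} => z i) (fun a => a != o)) /=;
    last by move=> z /andP[].
  rewrite mulr_natl -sumr_const; apply: eq_bigr => a ao.
  rewrite -(sum_cell_setval k x g iS ao bo); apply: eq_bigl => z.
  rewrite [in RHS]inE -andbA; congr (_ && _).
  by have [->|] := eqVneq (z i) a; rewrite ?ao ?andbF.
- by move=> [y j] /and3P[/= yA jS yj]; apply: close.
Qed.

(** An exchange touches [i] and one other coordinate [j] of [S], whose cost
    [c j] is at most [c i] by maximality. *)
Lemma mean_cell_close (R : realType) k S x i a b (c : 'I_n -> R) (f : _ -> R) :
  (forall j, 0 <= c j) -> bounded_differences c f ->
  i \in S -> (forall j, j \in S -> c j <= c i) ->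
  cell k S x i a != finset.set0 -> cell k S x i b != finset.set0 ->
  `|mean (cell k S x i a) f - mean (cell k S x i b) f| <= 2 * c i.
Proof.
move=> c0 bdf iS cmax.
have zero_case b' : b' != o -> cell k S x i o != finset.set0 ->
    cell k S x i b' != finset.set0 ->
    `|mean (cell k S x i o) f - mean (cell k S x i b') f| <= 2 * c i.
  move=> bo Ao Ab; apply: mean_cell_zero => // y j.
  rewrite inE => /andP[_ /eqP yio] jS yj.
  have ij : i != j by apply: contraNneq yj => <-; rewrite yio.
  apply: le_trans (bounded_differences_on (U := [set i; j]) c0 bdf _) _.
    move=> l; rewrite !inE negb_or => /andP[li lj].
    by rewrite !ffunE (negbTE li) tpermD // eq_sym.
  rewrite big_setU1 ?inE // big_set1.
  by rewrite mulr_natl mulr2n lerD2l cmax.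
have [->|ao] := eqVneq a o; have [->|bo] := eqVneq b o => Aa Ab.
- by rewrite subrr normr0 mulr_ge0.
- exact: zero_case.
- by rewrite distrC zero_case.
apply: (@mean_coupling _ _ _ _ _ (mem (cell k S x i a)) id (setval i b) 1 1)
  => // [g|g|y _].
- by rewrite mul1r.
- by rewrite mul1r; apply: sum_cell_setval.
apply: le_trans (bounded_differences_on (U := [set i]) c0 bdf _) _.
  by move=> l; rewrite inE ffunE => /negbTE ->.
rewrite big_set1; have := c0 i; lra.
Qed.

(** Induction on [#|S|], splitting along a coordinate of [S] where [c] is
    largest; [8 * c i ^+ 2] is the term [2 * D ^+ 2] of [sum_expR_partition]
    for [D = 2 * c i]. *)
Lemma slice_mgf (R : realType) k S x (c : 'I_n -> R) (f : _ -> R) :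
  (forall j, 0 <= c j) -> bounded_differences c f ->
  \sum_(y in slice k S x) expR (f y - mean (slice k S x) f) <=
  #|slice k S x|%:R * expR (8 * \sum_(j in S) c j ^+ 2).
Proof.
move=> c0 bdf; have [s] := ubnP #|S|; elim: s S x => // s IHs S x.
have [->|[i0 i0S]] := set_0Vmem S => [_|].
  rewrite big_set0 mulr0 expR0 mulr1 -sumr_const; apply: ler_sum => y yS.
  rewrite -expR0 ler_expR; apply: le_trans (ler_norm _) _.
  apply: dist_mean_le => [|z zS]; first by apply/set0Pn; exists y.
  suff -> : y = z by rewrite subrr normr0.
  by apply/ffunP => j; rewrite (slice_agree yS) ?(slice_agree zS) ?inE.
case: (@Order.TotalTheory.arg_maxP _ _ _ i0 (mem S) c i0S) => i iS cmax sz.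
have -> : 8 * \sum_(j in S) c j ^+ 2 =
    8 * \sum_(j in S :\ i) c j ^+ 2 + 2 * (2 * c i) ^+ 2.
  rewrite (big_setD1 i) //=; ring.
apply: (sum_expR_partition (g := fun y : {ffun 'I_n -> W} => y i)) => [a b|a].
  exact: mean_cell_close.
rewrite -/(cell k S x i a) cell_slice //; apply: IHs.
by move: sz; rewrite (cardsD1 i) (iS : i \in S).
Qed.

End Slices.

(** * Tails on a slice *)

Lemma slice_upper_tail (R : realType) (W : finType) (o : W) (n k : nat)
    (S : {set 'I_n}) (x : {ffun 'I_n -> W}) (c : 'I_n -> R)
    (f : {ffun 'I_n -> W} -> R) (t : R) :
  (forall j, 0 <= c j) -> bounded_differences c f -> 0 <= t ->
  0 < \sum_(j in S) c j ^+ 2 ->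
  mean (slice o k S x)
    (fun y => (t <= f y - mean (slice o k S x) f)%R%:R) <=
  expR (- (t ^+ 2 / (32 * \sum_(j in S) c j ^+ 2))).
Proof.
move=> c0 bdf t0; set A := slice o k S x; set C := \sum_(j in S) _ => C0.
(* This value minimises [8 * s ^+ 2 * C - s * t]. *)
pose s := t / (16 * C).
have s0 : 0 <= s by rewrite divr_ge0 // mulr_ge0 // ltW.
have := @slice_mgf _ o n R k S x (fun j => s * c j) (fun y => s * f y).
have -> : \sum_(j in S) (s * c j) ^+ 2 = s ^+ 2 * C.
  by rewrite mulr_sumr; apply: eq_bigr => j _; rewrite exprMn.
rewrite -/A meanZ => mgf.
have {}mgf : \sum_(y in A) expR (s * f y - s * mean A f) <=
    #|A|%:R * expR (8 * (s ^+ 2 * C)).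
  apply: mgf => [j|y z]; first exact: mulr_ge0.
  rewrite -mulrBr normrM ger0_norm //.
  under eq_bigr do rewrite -mulrA.
  by rewrite -mulr_sumr ler_wpM2l.
have [->|An0] := eqVneq A finset.set0.
  by rewrite /mean big_set0 mul0r expR_ge0.
have cA : 0 < #|A|%:R :> R by rewrite ltr0n card_gt0.
rewrite /mean ler_pdivrMr //.
have -> : - (t ^+ 2 / (32 * C)) = 8 * (s ^+ 2 * C) - s * t.
  by rewrite /s; field; rewrite gt_eqF.
rewrite expRB mulrAC ler_pdivlMr ?expR_gt0 // mulrC [X in _ <= X]mulrC.
apply: le_trans mgf; rewrite mulr_sumr; apply: ler_sum => y _.
rewrite -/(mean A f); case: (leP t (f y - mean A f)) => [ty|_];
  last by rewrite mulr0n mulr0 expR_ge0.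
by rewrite mulr1n mulr1 ler_expR -mulrBr ler_wpM2l.
Qed.

Lemma slice_tail (R : realType) (W : finType) (o : W) (n k : nat)
    (S : {set 'I_n}) (x : {ffun 'I_n -> W}) (c : 'I_n -> R)
    (f : {ffun 'I_n -> W} -> R) (t : R) :
  (forall j, 0 <= c j) -> bounded_differences c f -> 0 <= t ->
  0 < \sum_(j in S) c j ^+ 2 ->
  mean (slice o k S x)
    (fun y => (t <= `|f y - mean (slice o k S x) f|)%R%:R) <=
  2 * expR (- (t ^+ 2 / (32 * \sum_(j in S) c j ^+ 2))).
Proof.
move=> c0 bdf t0 C0; set A := slice o k S x.
have bdNf : bounded_differences c (fun y => -1 * f y).
  by move=> y z; rewrite -mulrBr mulN1r normrN.
have up := slice_upper_tail o k x c0 bdf t0 C0.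
have := slice_upper_tail o k x c0 bdNf t0 C0; rewrite -/A meanZ in up * => down.
rewrite mulr_natl mulr2n; apply: le_trans (lerD up down).
rewrite /mean -mulrDl -big_split ler_wpM2r ?invr_ge0 ?ler0n //.
apply: ler_sum => y _ /=; rewrite !mulN1r -opprD ler_normr -natrD ler_nat.
by case: (t <= f y - _); case: (t <= - _).
Qed.

(** * Laws of uniform variables *)

Local Open Scope classical_set_scope.

Section Uniform.
Variables (d : measure_display) (T : measurableType d) (R : realType).
Variables (P : probability T R) (S : finType) (eta : T -> S) (A : {set S}).
Hypothesis heta : uniform_on P eta A.

Lemma uniform_expectation (h : S -> R) :
  ('E_P[fun w => h (eta w)] = (mean A h)%:E)%E.
Proof.
have meta x : measurable (eta @^-1` [set x]) by have [] := heta x.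
have hE w : (h (eta w))%:E =
    (\sum_x (h x)%:E * (\1_(eta @^-1` [set x]) w)%:E)%E.
  rewrite (bigD1 (eta w)) //= big1 => [|x xw].
    by rewrite indicE mem_set //= mule1 adde0.
  rewrite indicE memNset ?mule0 //= => wx.
  by rewrite wx eqxx in xw.
have intg x : P.-integrable setT (EFin \o \1_(eta @^-1` [set x])).
  exact: integrable_indic.
rewrite unlock; under eq_integral do rewrite hE.
rewrite integral_sum //; last by move=> x; apply: integrableZl => //; exact: intg.
rewrite /mean [\sum_(y in A) _]big_mkcond mulr_suml /= -sumEFin.
apply: eq_bigr => x _.
rewrite integralZl //; last exact: intg.
rewrite integral_indic // setIT [X in (_ * X)%E](heta x).2 -EFinM.
by case: ifP => _; rewrite ?mul0r ?mulr0.
Qed.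

Lemma uniform_probability (B : pred S) :
  P [set w | B (eta w)] = (mean A (fun x => (B x)%:R))%:E.
Proof.
have mB : measurable [set w | B (eta w)].
  rewrite (_ : mkset _ = \bigcup_(x in [set` B]) (eta @^-1` [set x])).
    apply: fin_bigcup_measurable => [|x _]; first exact: finite_finset.
    by have [] := heta x.
  apply/seteqP; split=> w /=; first by exists (eta w).
  by case=> x /= Bx ->.
rewrite -(expectation_indic P mB) -uniform_expectation; congr expectation.
apply/funext => w; rewrite indicE.
case: (boolP (B (eta w))) => Bw; first by rewrite mem_set.
by rewrite memNset //= (negbTE Bw).
Qed.

End Uniform.

(** * Concentration of the uniform vector of weight k *)

(* The quotient is taken in the extended reals, so that when all [c i] vanish
   the bound is 0 for [t > 0] and 2 for [t = 0]. *)
Theorem lemma3p2 (R : realType) (q n k : nat)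
    (hq : (2 <= q)%N) (hn : (1 <= n)%N) (hk : (k <= n)%N)
    (f : {ffun 'I_n -> 'I_q} -> R) (c : 'I_n -> R)
    (hf : bounded_differences c f)
    (d : measure_display) (T : measurableType d) (P : probability T R)
    (eta : T -> {ffun 'I_n -> 'I_q})
    (heta : uniform_on P eta [set x : {ffun 'I_n -> 'I_q} | wt x == k]%SET)
    (t : R) (ht : 0 <= t) :
  (P [set w | (t <= `|f (eta w) - fine 'E_P[fun w' => f (eta w')]|)%R]%classic <=
   2%:E * expeR (- ((t ^+ 2)%:E / (68 * \sum_(i < n) c i ^+ 2)%:E)))%E.
Proof.
case: q hq f hf eta heta => [//|[//|q]] _ f hf eta heta.
pose x0 : {ffun 'I_n -> 'I_q.+2} := [ffun=> ord0].
have sliceE : [set x : {ffun 'I_n -> 'I_q.+2} | wt x == k]%SET =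
    slice ord0 k [set: 'I_n]%SET x0.
  apply/setP => x; rewrite !inE [X in _ && X](_ : _ = true) ?andbT //.
  by apply/forallP => j; rewrite inE.
rewrite sliceE in heta; set A := slice _ _ _ _ in heta.
have c0 : forall i, 0 <= c i.
  apply: bounded_differences_ge0 hf.
  exact: (isT : ord0 != ord_max :> 'I_q.+2).
rewrite (uniform_expectation heta) // /=.
rewrite (uniform_probability heta (fun x => t <= `|f x - mean A f|)).
set C := \sum_(i < n) _.
have C0 : 0 <= C by apply: sumr_ge0 => i _; apply: sqr_ge0.
have CE : \sum_(i in [set: 'I_n]%SET) c i ^+ 2 = C.
  by apply: eq_bigl => i; rewrite inE.
move: C0; rewrite le_eqVlt => /orP[/eqP C0|Cgt0]; last first.
  rewrite inver mulf_eq0 !gt_eqF //= -EFinM lee_fin.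
  have := slice_tail (S := [set: 'I_n]%SET) ord0 k x0 c0 hf ht.
  rewrite CE => /(_ Cgt0) tail.
  apply: le_trans tail _; rewrite ler_pM2l // ler_expR lerN2.
  rewrite ler_wpM2l ?sqr_ge0 // lef_pV2 ?posrE ?mulr_gt0 // ler_pM2r //.
  by rewrite ler_nat.
(* Here all [c i] vanish: [f] is constant, and the bound is [0] or [2]. *)
have ci0 i : c i = 0.
  move/eqP: (esym C0); rewrite psumr_eq0 => [/allP/(_ i (mem_index_enum i))|j _].
    by rewrite /= sqrf_eq0 => /eqP.
  exact: sqr_ge0.
have mean_f x : x \in A -> f x - mean A f = 0.
  move=> xA; apply/eqP; rewrite -normr_le0; apply: dist_mean_le => [|y _].
    by apply/set0Pn; exists x.
  by apply: le_trans (hf x y) _; rewrite big1 // => i _; rewrite ci0 mul0r.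
rewrite -C0 mulr0 inver eqxx.
move: ht; rewrite le_eqVlt => /orP[/eqP <-|t0].
  rewrite expr0n /= mul0e oppe0 expeR0 mule1 lee_fin.
  have [->|An0] := eqVneq A finset.set0; first by rewrite /mean big_set0 mul0r.
  rewrite /mean ler_pdivrMr ?ltr0n ?card_gt0 // mulr_natl mulr2n -sumr_const.
  rewrite ler_wpDr ?sumr_ge0 // ler_sum // => x _.
  by rewrite lern1 leq_b1.
rewrite /mean big1 => [|x xA].
  by rewrite mul0r mule_ge0 // expeR_ge0.
by rewrite mean_f // normr0 leNgt t0.
Qed.
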